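(* Let $2\le d\le n$ be integers and let $G$ be any hypergraph on vertex set $[n]$, and let $k(G) = \min_{e \in E(G)} |e|$. If $(d-1)k(G) > n-1$, then $\beta^d(G) \leq \left\lceil \frac{n-1}{d-1} \right\rceil(d+1)$.
   Context: For $S\subseteq [n]$, a bicoloring of $S$ is a map $X^S:S\to\{+1,-1\}$; write $X^S(+1)$, $X^S(-1)$ for the sets of vertices colored $+1$, $-1$. A hyperedge $A$ is induced-bisected by $X^S$ if $|A\cap X^S(+1)|=|A\cap X^S(-1)|\neq 0$. The trivial hyperedges are the empty set and the singletons, together with $[n]$ when $d$ is odd. A set $\{X^{S_1},\ldots,X^{S_t}\}$ of bicolorings is an induced-bisecting family of order $d$ for $G$ if each $S_i\subseteq[n]$ has exactly $d$ elements and every non-trivial hyperedge of $G$ is induced-bisected by at least one $X^{S_i}$. $\beta^d(G)$ is the minimum cardinality of an induced-bisecting family of order $d$ for $G$.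
   Formalization: For d = n an induced-bisecting family need not exist (e.g. n = d = 4 with the single hyperedge {1,2,3}); the bound is therefore proved for d = n only when β^d(G) exists, while for d < n its existence is proved as well. *)

(* Defs.v *)
From mathcomp Require Import all_boot all_order all_algebra.

Set Implicit Arguments.
Unset Strict Implicit.
Unset Printing Implicit Defensive.

(* The vertex set [n] is 'I_n; a hypergraph is an arbitrary set of subsets
   of [n] (the empty set, singletons and [n] itself are allowed edges). *)
Definition hypergraph (n : nat) := {set {set 'I_n}}.

(* k(G).  Since every edge has at most n vertices, the default n does not
   affect the minimum when G has an edge; an edgeless G gets k(G) = n. *)
Definition min_edge_size (n : nat) (G : hypergraph n) : nat :=
  \big[minn/n]_(e in G) #|e|.

(* A bicoloring X^S : S -> {+1, -1}, encoded as a partial function on [n] with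
   domain S: Some true is +1, Some false is -1, and None means "not in S". *)
Definition bicoloring (n : nat) := {ffun 'I_n -> option bool}.

Definition domain (n : nat) (X : bicoloring n) : {set 'I_n} :=
  [set i | isSome (X i)].

Definition color_class (n : nat) (X : bicoloring n) (c : bool) : {set 'I_n} :=
  [set i | X i == Some c].

Definition induced_bisected (n : nat) (X : bicoloring n) (A : {set 'I_n})
  : bool :=
  (#|A :&: color_class X true| == #|A :&: color_class X false|)
  && (#|A :&: color_class X false| != 0).

Definition trivial_edge (n d : nat) (A : {set 'I_n}) : bool :=
  [|| A == set0, #|A| == 1 | odd d && (A == [set: 'I_n])].

Definition induced_bisecting_family (n d : nat) (G : hypergraph n)
    (F : {set bicoloring n}) : Prop :=
  (forall X, X \in F -> #|domain X| = d) /\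
  (forall A, A \in G -> ~~ trivial_edge d A ->
     exists2 X, X \in F & induced_bisected X A).

(* [is_beta d G b] means beta^d(G) = b.  It is a relation rather than a
   function because some G have no induced-bisecting family of order d: for
   d = n every S_i is [n], so an edge A of odd size with 3 <= #|A| < n is
   non-trivial but is never bisected. *)
Definition is_beta (n d : nat) (G : hypergraph n) (b : nat) : Prop :=
  (exists2 F : {set bicoloring n}, induced_bisecting_family d G F & #|F| = b) /\
  (forall F : {set bicoloring n}, induced_bisecting_family d G F -> b <= #|F|).

(* Main.v *)
Require Import Defs.
From mathcomp Require Import all_boot all_order all_algebra.
From mathcomp Require Import zify.
Import Order.TTheory GRing.Theory Num.Theory.

(* Let Z be a set of odd size 2a+1 in cyclic order, and consider its 2a+1
   rotations: omit one vertex, color the next a vertices +1 and the last a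
   vertices -1.  For a subset B of Z that is neither empty nor Z, the imbalance
   of B takes each of the values -1, 0, 1 along the rotations: it sums to 0, it
   changes by at most 2 per step, and jumping up over a value and jumping down
   over it require opposite parities of |B|.  Hence the rotations still work
   after adding a few vertices of constant color.

   With d+1 rotations one bisects every edge meeting a (d+1)-set T in at least
   two vertices (and not containing T, if d is odd).  To cover [n], use several
   such sets that share two vertices: if one of them is contained in an edge,
   then all are, or some other set is met properly in at least two vertices.
   Pigeonhole settles n - 1 <= (k - 1)(d - 1).  Otherwise edges that meet every
   set exactly once remain, so one replaces two of the sets by a set V with at
   most 2d - 2 vertices, on which 2(d+1) colorings suffice: write V = T u Q with
   |T| = d+1, rotate T economically with constant vertices, rotate a set that
   contains Q, and spend the four remaining colorings on the edges that meet T
   and Q once each.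

   For d = n every non-trivial edge is even, and the n+1 prefix colorings do. *)

(** * Integer sequences and the imbalance along the rotations of a cyclic order *)

Lemma crossing (f : nat -> int) (c : int) (i j : nat) :
  i <= j -> (f i < c)%R -> (c < f j)%R -> (forall k, f k <> c) ->
  exists k, (f k < c)%R /\ (c < f k.+1)%R.
Proof.
move=> leij fi fj fc; rewrite -(subnKC leij) in fj.
elim: (j - i)%N fj => [|l IH] fj; first by move: fj; rewrite addn0; lia.
have [/IH//|lc] := boolP (c < f (i + l)%N)%R.
exists (i + l); split; last by rewrite -addnS.
by have := fc (i + l); lia.
Qed.

Section Rotation.
Variables (b : nat -> bool) (a : nat).
Hypothesis bP : forall k, b (k + a.*2.+1) = b k.

(* b is the indicator of an edge along the cyclic order.  In the k-th rotation
   vertex k is omitted and [second k] counts the edge vertices colored -1, so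
   total - b k - second k are colored +1.  The parity of [bias k] is visible in
   this form. *)
Definition total := \sum_(0 <= i < a.*2.+1) b i.
Definition second k := \sum_(a.+1 <= i < a.*2.+1) b (k + i).
Definition bias k : int := (total%:Z - (b k)%:Z - 2 * (second k)%:Z)%R.

Lemma window_total k : \sum_(0 <= i < a.*2.+1) b (k + i) = total.
Proof.
elim: k => [//|k IH].
have -> : \sum_(0 <= i < a.*2.+1) b (k.+1 + i) = \sum_(1 <= i < a.*2.+2) b (k + i).
  by rewrite [RHS]big_add1; apply: eq_bigr => i _; rewrite addSnnS.
by rewrite -IH big_nat_recr //= bP [RHS]big_ltn // addn0 addnC.
Qed.

Lemma bias_periodic k l : bias (k + l * a.*2.+1) = bias k.
Proof.
have bPl j : b (j + l * a.*2.+1) = b j.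
  by elim: l => [|l' IH]; rewrite ?addn0 // mulSn addnCA addnC bP.
rewrite /bias bPl; congr (_ - 2 * _%:Z)%R.
by apply: eq_bigr => i _; rewrite addnAC bPl.
Qed.

Lemma second_step k :
  second k.+1 + b (k + a.+1) = second k + b k.
Proof.
have -> : second k.+1 = \sum_(a.+2 <= i < a.*2.+2) b (k + i).
  by rewrite big_add1; apply: eq_bigr => i _; rewrite addSnnS.
case: (posnP a) => [a0|a0].
  by rewrite /second a0 !big_geq //; have := bP k; rewrite a0 /= => ->.
rewrite /second [in RHS]big_ltn; last by lia.
by rewrite big_nat_recr /= ?bP; lia.
Qed.

Lemma bias_step k :
  bias k.+1 = (bias k - (b k)%:Z - (b k.+1)%:Z + 2 * (b (k + a.+1)%N)%:Z)%R.
Proof. by have := second_step k; rewrite /bias; lia. Qed.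

(** The biases add up to zero over one period: each edge vertex is omitted in one rotation and
    colored -1 in [a] of them, and 1 + 2a is the number of rotations. Both sides are kept in [nat]
    so that [leqif_sum] applies. *)
Lemma bias_sum :
  \sum_(k < a.*2.+1) (b k + 2 * second k) = \sum_(k < a.*2.+1) total.
Proof.
have total_ord : \sum_(k < a.*2.+1) b k = total by rewrite /total big_mkord.
rewrite big_split /= total_ord -big_distrr /second exchange_big /=.
rewrite (eq_big_nat _ _ (F2 := fun=> total)) => [|i _]; last first.
  by rewrite -(window_total i) big_mkord; apply: eq_bigr => k _; rewrite addnC.
by rewrite sum_nat_const_nat sum_nat_const card_ord; lia.
Qed.

Lemma bias_signs : (exists i j, (bias i < 0)%R /\ (0 < bias j)%R) \/
  (forall k, bias k = 0%R).
Proof.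
have lt0 k : k %% a.*2.+1 < a.*2.+1 by rewrite ltn_mod.
have bias_ord k : bias k = bias (k %% a.*2.+1).
  by rewrite [in LHS](divn_eq k a.*2.+1) addnC bias_periodic.
have [/existsP[i ni]|/existsPn nneg] := boolP [exists k : 'I_a.*2.+1, (bias k < 0)%R].
  have [/existsP[j pj]|/existsPn npos] := boolP [exists k : 'I_a.*2.+1, (0 < bias k)%R].
    by left; exists i, j.
  (* With no positive bias, a termwise inequality between equal sums is an equality in every term,
     which contradicts [ni]. *)
  have le_total (k : 'I_a.*2.+1) : true -> total <= b k + 2 * second k ?= iff
      (total == b k + 2 * second k).
    by move=> _; apply: leqif_eq; have := npos k; rewrite /bias; lia.
  have [_] := leqif_sum le_total; rewrite bias_sum eqxx => /esym/forallP all0.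
  by have := all0 i; move: ni; rewrite /bias /= => ni /eqP; lia.
right=> k; rewrite bias_ord.
have ge_total (l : 'I_a.*2.+1) : true -> b l + 2 * second l <= total ?= iff
    (b l + 2 * second l == total).
  by move=> _; apply: leqif_eq; have := nneg l; rewrite /bias; lia.
have [_] := leqif_sum ge_total; rewrite bias_sum eqxx.
by move=> /esym/forallP/(_ (Ordinal (lt0 k))) /= /eqP; rewrite /bias; lia.
Qed.

Lemma bias_intermediate c i j : (bias i < c)%R -> (c < bias j)%R ->
  exists k, bias k = c.
Proof.
move=> bi bj; have [/existsP[k /eqP<-]|/existsPn nc] :=
  boolP [exists k : 'I_a.*2.+1, bias k == c]; first by exists k.
have {}nc k : bias k <> c.
  move=> bk; have lt0 : k %% a.*2.+1 < a.*2.+1 by rewrite ltn_mod.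
  have := nc (Ordinal lt0); rewrite -bk [in bias k](divn_eq k a.*2.+1) addnC.
  by rewrite bias_periodic eqxx.
(* Periodicity puts a copy of j after i and a copy of i after j, so the sequence has to jump over c
   in both directions. *)
have le_shift x y : x <= y + x * a.*2.+1 by lia.
have {}bj : (c < bias (j + i * a.*2.+1)%N)%R by rewrite bias_periodic.
have [u [u1 u2]] := crossing _ _ _ _ (le_shift i j) bi bj nc.
have {}bj : (- bias j < - c)%R by rewrite ltrN2 -(bias_periodic j i).
have {}bi : (- c < - bias (i + j * a.*2.+1)%N)%R by rewrite bias_periodic ltrN2.
have [|v [v1 v2]] := crossing (fun k => - bias k)%R _ _ _ (le_shift j i) bj bi.
  by move=> k /oppr_inj/nc.
(* A jump up over c forces b u = 0 and a jump down forces b v = 1, so the bias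
   before the jump gives total = c - 1 and total = c + 2 modulo 2. *)
have := bias_step u; have := bias_step v; move: u1 u2 v1 v2.
rewrite !bias_step /bias.
case: (b u) (b u.+1) (b (u + _)) (b v) (b v.+1) (b (v + _)) => [] [] [] [] [] [] /=; lia.
Qed.

(** With zero bias at k and k+1, [bias_step] reads b k + b (k+1) = 2 b (k+a+1), so consecutive
    values have the same parity. *)
Lemma bias_const : (forall k, bias k = 0%R) -> forall k, b k = b 0.
Proof.
move=> bias0; elim=> // k <-.
by have := bias_step k; rewrite !bias0; case: (b k) (b k.+1) (b _) => [] [] []; lia.
Qed.

Lemma bias_attains c : 0 < total < a.*2.+1 -> (-1 <= c <= 1)%R -> exists k, bias k = c.
Proof.
move=> /andP[t0 tL] c1; case: bias_signs => [[i [j [bi bj]]]|/bias_const bc].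
  (* Here bias i <= -1 and bias j >= 1, so a value c in [-1, 1] that is not strictly between them
     equals one of them. *)
  have [ci|ci] := boolP (bias i < c)%R; last by exists i; lia.
  have [cj|cj] := boolP (c < bias j)%R; last by exists j; lia.
  exact: bias_intermediate ci cj.
move: t0 tL; rewrite /total (eq_bigr (fun=> nat_of_bool (b 0))) => [|k _]; last by rewrite bc.
by rewrite sum_nat_const_nat; case: (b 0); lia.
Qed.

Lemma bias_attains0 : exists k, bias k = 0%R.
Proof.
case: bias_signs => [[i [j [bi bj]]]|b0]; last by exists 0.
exact: bias_intermediate bi bj.
Qed.

End Rotation.

(** * Bicolorings and the families obtained by rotation *)

Section Colorings.
Variable n : nat.
Implicit Types (P R A Q T Z U V W : {set 'I_n}) (F : {set bicoloring n}).

Definition bicolor P R : bicoloring n :=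
  [ffun i => if i \in P then Some true else if i \in R then Some false else None].

Lemma domain_bicolor P R : domain (bicolor P R) = P :|: R.
Proof. by apply/setP=> i; rewrite !inE ffunE; case: ifP => //; case: ifP. Qed.

Lemma bicolor_bisected P R A : [disjoint P & R] ->
  #|A :&: P| = #|A :&: R| -> 0 < #|A :&: P| -> induced_bisected (bicolor P R) A.
Proof.
move=> dPR eqPR A0; rewrite /induced_bisected.
have -> : color_class (bicolor P R) true = P.
  by apply/setP=> i; rewrite !inE ffunE; case: ifP => //; case: ifP.
have -> : color_class (bicolor P R) false = R.
  apply/setP=> i; rewrite !inE ffunE; case: ifP => [iP|_]; last by case: ifP.
  by rewrite (disjointFr dPR iP).
by rewrite eqPR eqxx -eqPR -lt0n.
Qed.

Lemma card_setI_seq A (t : seq 'I_n) : uniq t ->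
  #|A :&: [set z in t]| = \sum_(z <- t) (z \in A).
Proof.
move=> ut; rewrite -[RHS]big_mkcond /= sum1_count.
rewrite -size_filter -(card_uniqP _) ?filter_uniq //.
by apply: eq_card => z; rewrite !inE mem_filter.
Qed.

(** Z is rotated while U stays +1 and W stays -1, so A is balanced by a rotation of bias |A n W| -
    |A n U|. Bias 0 always occurs, and the extra condition keeps A from losing all its colored
    vertices; bias 1 or -1 requires that A meet Z properly. *)
Lemma rotation_family d Z U W : odd #|Z| ->
  [disjoint Z & U] -> [disjoint Z & W] -> [disjoint U & W] ->
  #|Z|.-1 + #|U| + #|W| = d ->
  exists F, [/\ #|F| <= #|Z|, forall X, X \in F -> #|domain X| = d,
    forall A, #|A :&: U| = #|A :&: W| -> 1 < #|A :&: Z| \/ 0 < #|A :&: U| ->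
      exists2 X, X \in F & induced_bisected X A &
    forall A, #|A :&: U| = #|A :&: W|.+1 \/ #|A :&: W| = #|A :&: U|.+1 ->
      0 < #|A :&: Z| < #|Z| -> exists2 X, X \in F & induced_bisected X A].
Proof.
move=> oZ dZU dZW dUW cardd.
have [a cardZ] : exists a, #|Z| = a.*2.+1.
  by exists #|Z|./2; rewrite -[LHS]odd_double_half oZ.
set L := a.*2.+1 in cardZ.
have /set0Pn[x0 _] : Z != set0 by rewrite -card_gt0 cardZ.
pose e i := nth x0 (enum Z) (i %% L).
have sizeZ : size (enum Z) = L by rewrite -cardE.
have e_mod i : i %% L < size (enum Z) by rewrite sizeZ ltn_mod.
have eZ i : e i \in Z by rewrite -mem_enum mem_nth.
have eL i : e (i + L) = e i by rewrite /e modnDr.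
pose t k := [seq e (k + i) | i <- index_iota a.+1 L].
have ut k : uniq (e k :: t k).
  have -> : e k :: t k = [seq e (k + i) | i <- 0 :: index_iota a.+1 L].
    by rewrite /= addn0.
  rewrite map_inj_in_uniq; first by rewrite /= iota_uniq mem_index_iota.
  have ltL i : i \in 0 :: index_iota a.+1 L -> i < L.
    by rewrite inE mem_index_iota => /orP[/eqP->|/andP[]].
  move=> i j /ltL iL /ltL jL /eqP; rewrite nth_uniq ?enum_uniq // eqn_modDl.
  by rewrite !modn_small // => /eqP.
(* [R k] consists of the a vertices at cyclic positions k+a+1 to k+2a, colored -1; [P k] is the rest
   of Z without the omitted vertex [e k]. *)
pose R k := [set z in t k]; pose P k := Z :\ e k :\: R k.
have RZ k : R k \subset Z :\ e k.
  apply/subsetP=> z; rewrite !inE => zt; apply/andP; split.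
    by apply: contraTneq zt => ->; have /andP[] := ut k.
  by case/mapP: zt => i _ ->.
have cardP A k : #|A :&: P k| + #|A :&: R k| + (e k \in A) = #|A :&: Z|.
  rewrite (cardsD1 (e k) (A :&: Z)) !inE eZ andbT addnC; congr (_ + _).
  rewrite -(cardsID (R k) ((A :&: Z) :\ e k)) addnC; congr (_ + _); apply: eq_card => z.
    rewrite !inE; case zR: (z \in t k); rewrite ?andbF //= ?andbT.
    have /(subsetP (RZ k)) : z \in R k by rewrite inE.
    by rewrite !inE => /andP[-> ->]; rewrite andbT.
  by rewrite !inE; case: (z \in t k); rewrite ?andbF //=; rewrite andbCA.
have cardR A k : #|A :&: R k| = \sum_(a.+1 <= i < L) (e (k + i) \in A).
  by rewrite card_setI_seq ?big_map //; have /andP[] := ut k.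
have cardAZ A : \sum_(0 <= i < L) (e i \in A) = #|A :&: Z|.
  have -> : Z = [set z in enum Z] by apply/setP=> z; rewrite inE mem_enum.
  rewrite card_setI_seq ?enum_uniq // (big_nth x0) sizeZ.
  by apply: eq_big_nat => i /andP[_ iL]; rewrite /e modn_small.
pose X k := bicolor (P k :|: U) (R k :|: W).
have ek k : e k = e (k %% L) by rewrite /e modn_mod.
have Xk k : X k = X (k %% L).
  have ek' i : e (k + i) = e (k %% L + i) by rewrite /e modnDml.
  have tk : t k = t (k %% L) by apply: eq_map => i; rewrite ek'.
  by rewrite /X /P /R -tk -ek.
have PRd k : [disjoint P k & R k] by rewrite /P -setI_eq0 setIDAC setDIl setDv setI0.
have PZ k : P k \subset Z by apply: subset_trans (subsetDl _ _) (subsetDl _ _).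
have RZ' k : R k \subset Z by apply: subset_trans (RZ k) (subsetDl _ _).
have dPU k : [disjoint P k & U] := disjointWl (PZ k) dZU.
have dPW k : [disjoint P k & W] := disjointWl (PZ k) dZW.
have dRU k : [disjoint R k & U] := disjointWl (RZ' k) dZU.
have dRW k : [disjoint R k & W] := disjointWl (RZ' k) dZW.
have dX k : [disjoint P k :|: U & R k :|: W].
  rewrite -setI_eq0 setIUl !setIUr !disjoint_setI0 // ?setU0 //.
  by rewrite disjoint_sym.
have cardAU A (B C : {set 'I_n}) : [disjoint B & C] -> #|A :&: (B :|: C)| = #|A :&: B| + #|A :&: C|.
  move=> dBC; rewrite setIUr cardsU -setIIr (disjoint_setI0 dBC) setI0 cards0.
  by rewrite subn0.
exists [set X k | k : 'I_L].
have bisect A k : #|A :&: P k| + #|A :&: U| = #|A :&: R k| + #|A :&: W| ->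
    0 < #|A :&: P k| + #|A :&: U| ->
    exists2 Y, Y \in [set X k | k : 'I_L] & induced_bisected Y A.
  move=> eqA A0; exists (X (k %% L)).
    by apply/imsetP; exists (Ordinal (ltn_pmod k (isT : 0 < L))).
  by rewrite -Xk; apply: bicolor_bisected; rewrite ?cardAU.
split.
- by rewrite cardZ -[X in _ <= X]card_ord leq_imset_card.
- move=> _ /imsetP[k _ ->]; rewrite domain_bicolor -[_ :|: _]setTI cardAU //.
  rewrite !cardAU // !setTI.
  by have := cardP setT k; rewrite !setTI inE; move: cardd; rewrite cardZ /=; lia.
- move=> A eqUW A0; have [|k] := @bias_attains0 (fun i => e i \in A) a.
    by move=> i; rewrite eL.
  rewrite /bias /total /second cardAZ -cardR => biask; apply: (bisect A k); have := cardP A k; lia.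
move=> A h /andP[A0 AZ].
have [|||k] := @bias_attains (fun i => e i \in A) a _ (#|A :&: W|%:Z - #|A :&: U|%:Z)%R.
- by move=> i; rewrite eL.
- by rewrite /total cardAZ A0 -[a.*2.+1]cardZ.
- by lia.
rewrite /bias /total /second cardAZ -cardR => biask; apply: (bisect A k); have := cardP A k; lia.
Qed.

Lemma subset_between A Z s : A \subset Z -> #|A| <= s <= #|Z| ->
  exists P, [/\ A \subset P, P \subset Z & #|P| = s].
Proof.
move=> AZ /andP[As]; rewrite -(subnKC As).
elim: (s - #|A|)%N => [|k IH] leZ; first by exists A; rewrite addn0 subxx.
have [|P [AP PZ cardP]] := IH; first by apply: leq_trans leZ; rewrite addnS.
have /properP[_ [x xZ xP]] : P \proper Z by rewrite properEcard PZ cardP -addnS.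
exists (x |: P); rewrite cardsU1 xP cardP addnS; split=> //.
  by rewrite subsetU // AP orbT.
by rewrite subUset sub1set xZ.
Qed.

Lemma halves_cover Z s : s <= #|Z| <= s.*2 ->
  exists P R, [/\ P :|: R = Z, #|P| = s & #|R| = s].
Proof.
move=> /andP[sZ Z2s].
have [|P [_ PZ cardP]] := @subset_between set0 Z s (sub0set _).
  by rewrite cards0.
have [|R [DR RZ cardR]] := @subset_between (Z :\: P) Z s (subsetDl _ _).
  by rewrite sZ cardsD (setIidPr PZ) cardP; lia.
exists P, R; split=> //; apply/eqP; rewrite eqEsubset subUset PZ RZ /=.
by rewrite -(setID Z P) (setIidPr PZ) setUS.
Qed.

(** * Unions of families, and edges split between two disjoint sets *)

Definition order d F := forall X, X \in F -> #|domain X| = d.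
Definition bisects F A := exists2 X, X \in F & induced_bisected X A.

Lemma bisectsUl F F' A : bisects F A -> bisects (F :|: F') A.
Proof. by case=> X XF XA; exists X; rewrite // inE XF. Qed.

Lemma bisectsUr F F' A : bisects F' A -> bisects (F :|: F') A.
Proof. by rewrite setUC; apply: bisectsUl. Qed.

Lemma orderU d F F' : order d F -> order d F' -> order d (F :|: F').
Proof. by move=> dF dF' X; rewrite inE => /orP[/dF|/dF']. Qed.

Lemma cardU_le F F' c c' : #|F| <= c -> #|F'| <= c' -> #|F :|: F'| <= c + c'.
Proof. by move=> Fc Fc'; rewrite cardsU (leq_trans (leq_subr _ _)) ?leq_add. Qed.

Lemma bicolor_separates P R A : [disjoint P & R] ->
  #|A :&: P| = 1 -> #|A :&: R| = 1 -> induced_bisected (bicolor P R) A.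
Proof. by move=> dPR AP AR; apply: bicolor_bisected; rewrite ?AP. Qed.

Lemma card_setI1_sub A Z P x :
  #|A :&: Z| = 1 -> x \in A :&: P -> P \subset Z -> #|A :&: P| = 1.
Proof.
move=> AZ xAP PZ; apply/eqP; rewrite eqn_leq -{1}AZ subset_leq_card ?setIS //=.
by rewrite card_gt0; apply/set0Pn; exists x.
Qed.

(** U and V are each covered by two sets, possibly overlapping, of sizes s and d - s. Any choice of
    one set on each side gives order d, and some choice contains both vertices of A. *)
Lemma pair_family d V U : [disjoint V & U] -> #|V| = d.+1 -> 0 < #|U| -> #|U| + 3 <= d ->
  exists F, [/\ #|F| <= 4, order d F &
    forall A, #|A :&: V| = 1 -> #|A :&: U| = 1 -> bisects F A].
Proof.
move=> dVU cardV U0 Ud; pose s := uphalf #|U|.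
have sU : s <= #|U| <= s.*2 by rewrite /s; lia.
have [U1 [U2 [UE cU1 cU2]]] := halves_cover _ _ sU.
(* Since 2s <= |U| + 1 and |U| + 3 <= d, two sets of size d - s can cover the d+1 vertices of V. *)
have [V1 [V2 [VE cV1 cV2]]] : exists P R, [/\ P :|: R = V, #|P| = d - s & #|R| = d - s].
  by apply: halves_cover; rewrite cardV; lia.
have sub P R : P \in [:: U1; U2] -> R \in [:: V1; V2] ->
    [/\ P \subset U, R \subset V, [disjoint P & R] & #|domain (bicolor P R)| = d].
  move=> PU RV; have PU' : P \subset U.
    by move: PU; rewrite !inE -UE => /orP[]/eqP->; rewrite ?subsetUl ?subsetUr.
  have RV' : R \subset V.
    by move: RV; rewrite !inE -VE => /orP[]/eqP->; rewrite ?subsetUl ?subsetUr.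
  have dPR : [disjoint P & R].
    by apply: disjointWl PU' _; rewrite disjoint_sym; apply: disjointWl RV' _.
  split=> //; rewrite domain_bicolor cardsU (disjoint_setI0 dPR) cards0 subn0.
  have -> : #|P| = s by move: PU; rewrite !inE => /orP[]/eqP->.
  have -> : #|R| = d - s by move: RV; rewrite !inE => /orP[]/eqP->.
  by lia.
exists [set X in [seq bicolor P R | P <- [:: U1; U2], R <- [:: V1; V2]]]; split.
- by rewrite cardsE (leq_trans (card_size _)).
- by move=> X; rewrite inE => /allpairsP[[P R] [/= PU RV ->]]; case: (sub P R).
move=> A AV AU.
have [x] : exists x, x \in A :&: U by apply/set0Pn; rewrite -card_gt0 AU.
have [y] : exists y, y \in A :&: V by apply/set0Pn; rewrite -card_gt0 AV.
rewrite -UE -VE !inE => /andP[yA yV] /andP[xA xU].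
have [P PU xP] : exists2 P, P \in [:: U1; U2] & x \in P.
  by case/orP: xU => xU; [exists U1 | exists U2]; rewrite ?inE ?eqxx ?orbT.
have [R RV yR] : exists2 R, R \in [:: V1; V2] & y \in R.
  by case/orP: yV => yV; [exists V1 | exists V2]; rewrite ?inE ?eqxx ?orbT.
have [PU' RV' dPR _] := sub P R PU RV.
exists (bicolor P R); first by rewrite inE; apply/allpairsP; exists (P, R).
apply: bicolor_separates dPR _ _.
  by apply: (card_setI1_sub A U P x) AU _ PU'; rewrite inE xA; apply: xP.
by apply: (card_setI1_sub A V R y) AV _ RV'; rewrite inE yA; apply: yR.
Qed.

(** * Edges that meet a set of d+1 vertices at least twice *)

(** The exception for odd d becomes, for V = [n], exactly the trivial edge [n]. *)
Definition resolves d V F :=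
  forall A, 1 < #|A :&: V| -> ~~ (odd d && (V \subset A)) -> bisects F A.

Lemma card_setI_disjointU A P R : [disjoint P & R] ->
  #|A :&: (P :|: R)| = #|A :&: P| + #|A :&: R|.
Proof.
move=> dPR; rewrite setIUr cardsU -setIIr (disjoint_setI0 dPR) setI0 cards0.
by rewrite subn0.
Qed.

Lemma card_setI1 A x : #|A :&: [set x]| = (x \in A).
Proof.
case: (boolP (x \in A)) => [xA|/negPf xA].
  by rewrite (setIidPr _) ?cards1 // sub1set.
by apply: eq_card0 => y; rewrite !inE andbC; case: eqP => // ->.
Qed.

Lemma card_setI_lt A Z : (#|A :&: Z| < #|Z|) = ~~ (Z \subset A).
Proof.
have -> : (#|A :&: Z| < #|Z|) = (A :&: Z \proper Z) by rewrite properEcard subsetIr.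
by rewrite properE subsetIr subsetI subxx andbT.
Qed.

(** Since |V| = d+1 is even, a vertex p stays +1 and the other d are rotated. An edge through p
    needs bias -1, hence must miss a vertex of V. The count d, rather than d+1, is what
    [wide_family_odd] relies on. *)
Lemma tight_family_odd d V p : odd d -> #|V| = d.+1 -> p \in V ->
  exists F, [/\ #|F| <= d, order d F & resolves d V F].
Proof.
move=> od cardV pV.
have cardZ : #|V :\ p| = d by move: (cardsD1 p V); rewrite pV cardV; lia.
have dZp : [disjoint V :\ p & [set p]] by rewrite disjoint_sym disjoints1 !inE eqxx.
have VE : V = (V :\ p) :|: [set p] by rewrite setUC setD1K.
have [|||||F [Fd dF h0 h1]] := rotation_family d (V :\ p) [set p] set0.
- by rewrite cardZ.
- by [].
- by rewrite -setI_eq0 setI0.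
- by rewrite -setI_eq0 setI0.
- by rewrite cardZ cards1 cards0; case: (d) od => //= *; lia.
exists F; split=> //; first by rewrite -cardZ.
move=> A AV; rewrite od /= => VA.
have := card_setI_disjointU A _ _ dZp; rewrite -VE card_setI1 => cardA.
case pA: (p \in A) cardA => cardA.
  apply: h1; first by left; rewrite card_setI1 pA setI0 cards0.
  rewrite card_setI_lt; apply/andP; split; first by lia.
  by apply: contra VA => ZA; rewrite VE subUset ZA sub1set.
by apply: h0; rewrite ?card_setI1 ?pA ?setI0 ?cards0 //; left; lia.
Qed.

Lemma tight_family d V : 1 < d -> #|V| = d.+1 ->
  exists F, [/\ #|F| <= d.+1, order d F & resolves d V F].
Proof.
move=> d1 cardV; have [od|ed] := boolP (odd d).
  have /set0Pn[p pV] : V != set0 by rewrite -card_gt0 cardV.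
  have [F [Fd dF rF]] := tight_family_odd d V p od cardV pV.
  by exists F; split=> //; apply: leqW.
have [|||||F [Fd dF h0 h1]] := rotation_family d V set0 set0;
  rewrite ?cardV ?cards0 /= ?addn0 -?setI_eq0 ?setI0 ?ed //.
by exists F; split; rewrite -?cardV // => A AV _; apply: h0; [rewrite !setI0 | left].
Qed.

(** * Sets with at most 2d - 2 vertices *)

Lemma disjointDl Z U : [disjoint Z :\: U & U].
Proof. by have := subxx (Z :\: U); rewrite subsetD => /andP[]. Qed.

Lemma two_subsets Z a b : a + b <= #|Z| ->
  exists U W, [/\ U \subset Z, W \subset Z, [disjoint U & W], #|U| = a & #|W| = b].
Proof.
move=> abZ; have [|U [_ UZ cardU]] := @subset_between set0 Z a (sub0set _).
  by rewrite cards0; lia.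
have [|W [_ WZ cardW]] := @subset_between set0 (Z :\: U) b (sub0set _).
  by rewrite cards0 cardsD (setIidPr UZ); lia.
by move: WZ; rewrite subsetD disjoint_sym => /andP[WZ dUW]; exists U, W.
Qed.

(** If A misses U and W, then it meets Q twice, and bias 0 works, or it meets T and Q once each, and
    [F'] works. Otherwise its only vertex in T lies in U or W, so A meets Q and hence Z; it cannot
    contain Z, because |Q| < |Z| would give it a second vertex in T. *)
Lemma loose_bisected F F' T Q Z U W A :
  [disjoint T & Q] -> U \subset T -> W \subset T -> [disjoint U & W] ->
  Q \subset Z -> Z \subset (T :|: Q) :\: (U :|: W) -> #|Q| < #|Z| ->
  (#|A :&: U| = #|A :&: W| -> 1 < #|A :&: Z| \/ 0 < #|A :&: U| -> bisects F A) ->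
  (#|A :&: U| = #|A :&: W|.+1 \/ #|A :&: W| = #|A :&: U|.+1 ->
    0 < #|A :&: Z| < #|Z| -> bisects F A) ->
  (#|A :&: T| = 1 -> #|A :&: Q| = 1 -> bisects F' A) ->
  #|A :&: T| <= 1 -> 1 < #|A :&: (T :|: Q)| -> bisects (F :|: F') A.
Proof.
move=> dTQ UT WT dUW QZ ZTQ QltZ h0 h1 h2 AT1.
rewrite card_setI_disjointU // => ATQ.
have AZQ : #|A :&: Q| <= #|A :&: Z| by rewrite subset_leq_card ?setIS.
have UWT : U :|: W \subset T by rewrite subUset UT WT.
have AUW : #|A :&: (U :|: W)| <= #|A :&: T| by rewrite subset_leq_card ?setIS.
have cUW := card_setI_disjointU A U W dUW.
case: (posnP #|A :&: (U :|: W)|) => [UW0|UW0].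
  have [AQ|AQ] := leqP #|A :&: Q| 1.
    by apply: bisectsUr; apply: h2; clear - AT1 ATQ AQ; lia.
  apply: bisectsUl; apply: h0; last by left; apply: leq_trans AQ AZQ.
  by clear - cUW UW0; lia.
apply: bisectsUl; apply: h1; first by clear - cUW UW0 AUW AT1; lia.
have AZ0 : 0 < #|A :&: Z| by clear - AZQ ATQ AT1; lia.
rewrite card_setI_lt AZ0 /=; apply/negP => ZA.
have dZUW : [disjoint Z :&: T & U :|: W].
  by apply: disjointWl (subsetIl _ _) _; move: ZTQ; rewrite subsetD => /andP[].
have := card_setI_disjointU A _ _ dZUW.
have -> : A :&: (Z :&: T) = Z :&: T.
  by apply/setIidPr; apply: subset_trans (subsetIl _ _) ZA.
have ZT : #|Z| <= #|Z :&: T| + #|Q|.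
  rewrite -(cardsID T Z) leq_add2l subset_leq_card // subDset.
  by apply: subset_trans ZTQ (subsetDl _ _).
have : #|A :&: (Z :&: T :|: (U :|: W))| <= #|A :&: T|.
  by rewrite subset_leq_card // setIS // subUset subsetIr.
by clear - ZT QltZ AT1 UW0; lia.
Qed.

(** The rotated set Z has size L, contains Q and avoids U and W; four more colorings come from
    [pair_family]. The last two conclusions catch the edges left over by the rotation within T, for
    even d and for odd d respectively. *)
Lemma outer_family d T Q U W L : [disjoint T & Q] -> #|T| = d.+1 ->
  0 < #|Q| -> #|Q| + 3 <= d -> U \subset T -> W \subset T -> [disjoint U & W] ->
  odd L -> #|Q| < L -> L.-1 + #|U| + #|W| = d ->
  exists F, [/\ #|F| <= L + 4, order d F,
    forall A, #|A :&: T| <= 1 -> 1 < #|A :&: (T :|: Q)| -> bisects F A,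
    forall A, U \subset A -> W \subset A -> #|U| = #|W| -> 0 < #|U| -> bisects F A &
    forall A, T \subset A -> ~~ (Q \subset A) -> #|U| = #|W|.+1 -> bisects F A].
Proof.
move=> dTQ cardT Q0 Qd UT WT dUW oL QL cardd.
have [F' [F'c dF' r']] := pair_family d T Q dTQ cardT Q0 Qd.
have UWT : U :|: W \subset T by rewrite subUset UT WT.
have [||Z [QZ ZV cardZ]] := @subset_between Q ((T :|: Q) :\: (U :|: W)) L.
- rewrite subsetD subsetUr disjoint_sym.
  exact: disjointWl UWT dTQ.
- rewrite ltnW // cardsD (setIidPr (subset_trans UWT (subsetUl _ _))).
  rewrite !cardsU (disjoint_setI0 dUW) (disjoint_setI0 dTQ) cards0 cardT.
  by clear - cardd Q0; lia.
have [ZTQ dZ] : Z \subset T :|: Q /\ [disjoint Z & U :|: W].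
  by move: ZV; rewrite subsetD => /andP[].
have [|||||F [Fc dF h0 h1]] := rotation_family d Z U W; rewrite ?cardZ //.
- exact: disjointWr (subsetUl _ _) dZ.
- exact: disjointWr (subsetUr _ _) dZ.
exists (F :|: F'); split.
- by apply: cardU_le; rewrite -?cardZ.
- exact: orderU.
- move=> A AT; apply: (loose_bisected F F' T Q Z U W A) => //.
  + by rewrite cardZ.
  + exact: h0.
  + exact: h1.
  + exact: r'.
- move=> A /setIidPr UA /setIidPr WA eqUW U0.
  by apply: bisectsUl; apply: h0; rewrite UA ?WA //; right.
move=> A TA QA eqUW; apply: bisectsUl; apply: h1.
  by left; rewrite !(setIidPr (subset_trans _ TA)).
rewrite card_setI_lt; apply/andP; split; last first.
  by apply: contra QA; apply: subset_trans QZ.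
apply: leq_trans (subset_leq_card (setSI Z TA)); rewrite setIC.
have : #|Z :\: T| <= #|Q| by rewrite subset_leq_card // subDset.
by have := cardsID T Z; rewrite cardZ; clear - QL; lia.
Qed.

(** The budget is exact: d colorings for T and (d - 2) + 4 for the outer family. Sizes 2 and 1 for U
    and W make L = d - 2 odd and give the imbalance that handles edges containing T but not Q. *)
Lemma wide_family_odd d T Q : odd d -> [disjoint T & Q] -> #|T| = d.+1 ->
  0 < #|Q| -> #|Q| + 3 <= d ->
  exists F, [/\ #|F| <= d.+1.*2, order d F & resolves d (T :|: Q) F].
Proof.
move=> od dTQ cardT Q0 Qd.
have /set0Pn[p pT] : T != set0 by rewrite -card_gt0 cardT.
have [F1 [F1c dF1 r1]] := tight_family_odd d T p od cardT pT.
have [|U [W [UT WT dUW cardU cardW]]] := two_subsets T 2 1.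
  by rewrite cardT; clear - Qd; lia.
have [|||F2 [F2c dF2 loose _ full]] :=
    outer_family d T Q U W (d - 2) dTQ cardT Q0 Qd UT WT dUW.
- by clear - od Qd; lia.
- by clear - od Q0 Qd; lia.
- by rewrite cardU cardW; clear - Qd; lia.
exists (F1 :|: F2); split.
- by apply: leq_trans (cardU_le _ _ _ _ F1c F2c) _; clear - Qd; lia.
- exact: orderU.
move=> A AV; rewrite od subUset negb_and /= => nA.
have [AT|AT] := leqP #|A :&: T| 1; first by apply: bisectsUr; apply: loose.
have [TA|TA] := boolP (T \subset A).
  by apply: bisectsUr; apply: full => //; [rewrite TA in nA | rewrite cardU cardW].
by apply: bisectsUl; apply: r1; rewrite ?od.
Qed.

(** The budget is again exact: (d - 1) + (d - 1) + 4. Keeping two vertices of T constant saves two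
    colorings, but fails on edges that contain the rest Z of T and exactly one of the two; taking U
    and W inside Z lets the outer family bisect those. *)
Lemma wide_family_even d T Q : ~~ odd d -> [disjoint T & Q] -> #|T| = d.+1 ->
  0 < #|Q| -> #|Q| + 3 <= d ->
  exists F, [/\ #|F| <= d.+1.*2, order d F & resolves d (T :|: Q) F].
Proof.
move=> ed dTQ cardT Q0 Qd.
have [|P [R [PT RT dPR cardP cardR]]] := two_subsets T 1 1.
  by rewrite cardT; clear - Qd; lia.
set Z := T :\: (P :|: R).
have cardPR : #|P :|: R| = 2.
  by rewrite cardsU (disjoint_setI0 dPR) cards0 cardP cardR.
have PRT : P :|: R \subset T by rewrite subUset PT.
have cardZ : #|Z| = d.-1.
  by rewrite cardsD (setIidPr PRT) cardT cardPR; clear - Qd; lia.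
have dZ : [disjoint Z & P :|: R] by apply: disjointDl.
have [|||||F1 [F1c dF1 h0 h1]] := rotation_family d Z P R;
  rewrite ?cardZ ?cardP ?cardR //.
- by clear - ed Qd; lia.
- exact: disjointWr (subsetUl _ _) dZ.
- exact: disjointWr (subsetUr _ _) dZ.
- by clear - Qd; lia.
have [|U [W [UZ WZ dUW cardU cardW]]] := two_subsets Z 1 1.
  by rewrite cardZ; clear - Qd Q0; lia.
have ZT : Z \subset T := subsetDl _ _.
have [|||F2 [F2c dF2 loose full _]] := outer_family d T Q U W d.-1 dTQ cardT Q0 Qd
    (subset_trans UZ ZT) (subset_trans WZ ZT) dUW.
- by clear - ed Qd; lia.
- by clear - Qd; lia.
- by rewrite cardU cardW; clear - Qd; lia.
exists (F1 :|: F2); split.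
- by apply: leq_trans (cardU_le _ _ _ _ F1c F2c) _; rewrite cardZ; clear - Qd; lia.
- exact: orderU.
move=> A AV _; have [AT1|AT1] := leqP #|A :&: T| 1.
  by apply: bisectsUr; apply: loose.
have TE : T = Z :|: (P :|: R) by rewrite setUC -{1}(setID T (P :|: R)) (setIidPr PRT).
have := card_setI_disjointU A _ _ dZ; rewrite -TE card_setI_disjointU // => AT.
have AP : #|A :&: P| <= 1 by rewrite -cardP subset_leq_card ?subsetIr.
have AR : #|A :&: R| <= 1 by rewrite -cardR subset_leq_card ?subsetIr.
have [eqPR|neqPR] := eqVneq #|A :&: P| #|A :&: R|.
  by apply: bisectsUl; apply: h0 => //; clear - eqPR AT AT1 AP; lia.
have [AZ|] := boolP (#|A :&: Z| < #|Z|).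
  apply: bisectsUl; apply: h1; first by clear - neqPR AP AR; lia.
  by rewrite AZ andbT; clear - AT AT1 neqPR AP AR; lia.
rewrite card_setI_lt negbK => ZA; apply: bisectsUr.
by apply: full; rewrite ?cardU ?cardW //; apply: subset_trans ZA.
Qed.

Lemma wide_family d V : 1 < d -> d < #|V| -> #|V| + 2 <= d.*2 ->
  exists F, [/\ #|F| <= d.+1.*2, order d F & resolves d V F].
Proof.
move=> d1 dV Vd; have [cardV|neqV] := eqVneq #|V| d.+1.
  have [F [Fc dF rF]] := tight_family d V d1 cardV.
  by exists F; split=> //; apply: leq_trans Fc _; rewrite -addnn leq_addr.
have [|T [_ TV cardT]] := @subset_between set0 V d.+1 (sub0set _).
  by rewrite cards0.
have -> : V = T :|: (V :\: T) by rewrite -{1}(setID V T) (setIidPr TV).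
have dTQ : [disjoint T & V :\: T] by rewrite disjoint_sym disjointDl.
have cardQ : #|V :\: T| = #|V| - d.+1 by rewrite cardsD (setIidPr TV) cardT.
have [Q0 Qd] : 0 < #|V :\: T| /\ #|V :\: T| + 3 <= d.
  by rewrite cardQ; clear - neqV dV Vd; lia.
by have [od|ed] := boolP (odd d); [apply: wide_family_odd | apply: wide_family_even].
Qed.

(** * Covering [n] by sets that share two vertices *)

(* C is the common part of all the sets in the star.  The second disjunct is what
   makes the induction work for odd d: when one of the sets lies inside A, it is
   through C that A meets all the others in at least two vertices. *)
Definition star_resolves d (C : {set 'I_n}) V r F :=
  forall A, r < #|A :&: V| \/ C \subset A -> ~~ (odd d && (V \subset A)) -> bisects F A.

(** Each step adds a set T of d+1 vertices through C, which covers up to d - 1 new vertices at the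
    cost of d+1 colorings. An edge not containing C contains none of the sets, so pigeonhole settles
    it. The starting size [s] and cost [c] are left open to allow a start from d+1 or from 2d - 2
    vertices. *)
Lemma star_family d (C : {set 'I_n}) c s :
  1 < d -> #|C| = 2 -> d < s ->
  (forall V, d < #|V| <= s -> exists F, [/\ #|F| <= c, order d F & resolves d V F]) ->
  forall i V, C \subset V -> d < #|V| <= s + i * d.-1 ->
  exists F, [/\ #|F| <= c + i * d.+1, order d F & star_resolves d C V i.+1 F].
Proof.
move=> d1 cardC ds base; elim=> [|i IH] V CV.
  rewrite mul0n !addn0 => /base[F [Fc dF rF]]; exists F; split=> // A [AV|CA].
    exact: rF.
  by apply: rF; rewrite -cardC subset_leq_card // subsetI CA.
rewrite !mulSn => /andP[dV Vs].
have [|T [CT TV cardT]] := @subset_between C V d.+1 CV.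
  by rewrite cardC; clear - d1 dV; lia.
have DV : (V :\: T) :|: C \subset V by rewrite subUset subsetDl CV.
(* The maximum keeps more than d vertices in V', if necessary by letting it share more than C with
   T. *)
have [|V' [DV' V'V cardV']] := @subset_between _ V (maxn d.+1 (#|V| - d.-1)) DV.
  have : #|(V :\: T) :|: C| <= #|V :\: T| + #|C| by rewrite cardsU leq_subr.
  by rewrite cardC cardsD (setIidPr TV) cardT; clear - d1 dV; lia.
have CV' : C \subset V' by apply: subset_trans DV'; rewrite subsetUr.
have VE : V = T :|: V'.
  apply/eqP; rewrite eqEsubset subUset TV V'V !andbT -subDset.
  by apply: subset_trans DV'; rewrite subsetUl.
have [F1 [F1c dF1 r1]] := tight_family d T d1 cardT.
have [|F2 [F2c dF2 r2]] := IH V' CV'.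
  rewrite cardV'; move: (i * _) Vs => t; clear - d1 ds dV; lia.
exists (F1 :|: F2); split; first by rewrite addnCA; apply: cardU_le.
  exact: orderU.
move=> A hA; rewrite VE subUset => nA.
have [CA|CA] := boolP (C \subset A).
  have AT : 1 < #|A :&: T| by rewrite -cardC subset_leq_card // subsetI CA.
  have [nT|] := boolP (~~ (odd d && (T \subset A))).
    by apply: bisectsUl; apply: r1.
  rewrite negbK => /andP[od TA]; apply: bisectsUr; apply: r2; first by right.
  by move: nA; rewrite od TA.
have nsub Z : C \subset Z -> ~~ (odd d && (Z \subset A)).
  by move=> CZ; apply: contra CA => /andP[_]; apply: subset_trans.
case: hA => [|CA']; last by rewrite CA' in CA.
rewrite VE => AV.
have [AT|AT] := leqP #|A :&: T| 1; last by apply: bisectsUl; apply: r1; rewrite ?nsub.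
apply: bisectsUr; apply: r2; rewrite ?nsub //; left.
by move: AV; rewrite setIUr cardsU; clear - AT; lia.
Qed.

Lemma exists_family d k m : 1 < d -> d < n -> n - 1 < (d - 1) * k -> n - 1 <= m * (d - 1) ->
  exists F, [/\ #|F| <= m * d.+1, order d F &
    forall A, k <= #|A| -> ~~ (odd d && (A == [set: 'I_n])) -> bisects F A].
Proof.
move=> d1 dn nk nm.
have [|C [_ _ cardC]] := @subset_between set0 [set: 'I_n] 2 (sub0set _).
  by rewrite cards0 cardsT card_ord; clear - d1 dn; lia.
have CT : C \subset [set: 'I_n] := subsetT C.
have finish c i F : #|F| <= c -> c <= m * d.+1 -> i < k -> order d F ->
    star_resolves d C [set: 'I_n] i F -> exists F, [/\ #|F| <= m * d.+1, order d F &
    forall A, k <= #|A| -> ~~ (odd d && (A == [set: 'I_n])) -> bisects F A].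
  move=> Fc cm ik dF rF; exists F; split=> //; first exact: leq_trans Fc cm.
  move=> A kA nA; apply: rF; first by left; rewrite setIT (leq_trans ik).
  by rewrite subTset.
have [e de] : exists e, d = e.+2 by exists (d - 2); clear - d1; lia.
have {}nm : n <= m * e.+1 + 1 by move: nm; rewrite de subn1 /=; clear; lia.
have {}nk : n <= e.+1 * k by move: nk; rewrite de subn1 /=; clear - d1 dn; lia.
have cardT : #|[set: 'I_n]| = n by rewrite cardsT card_ord.
have [nk1|nk1] := leqP n ((k - 1) * e.+1 + 1).
  have [p [pE p0 pm pk]] : exists p, [/\ n <= p.+1 * e.+1 + 1, 0 < k, p.+1 <= m & p.+1 < k].
    have n1 : 1 < n by clear - d1 dn; lia.
    (* The number p+1 of sets is bounded by m for the budget and by k - 1 for pigeonhole. *)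
    exists (minn m (k - 1)).-1.
    have m0 : 0 < m by case: (m) nm n1 => // ; lia.
    have k0 : 0 < k - 1 by case: (k - 1) nk1 n1 => //; lia.
    have -> : (minn m (k - 1)).-1.+1 = minn m (k - 1) by clear - m0 k0; lia.
    by split; [rewrite /minn; case: ifP | clear - m0 k0; lia..].
  have [||F [Fc dF rF]] := star_family d C d.+1 d.+1 d1 cardC (leqnn _) _ p _ CT.
  - by move=> V; rewrite -eqn_leq eq_sym => /eqP; apply: tight_family.
  - by rewrite cardT dn de /=; move: pE; rewrite mulSn; clear; lia.
  by apply: finish Fc _ pk dF rF; rewrite -mulSn leq_mul2r pm orbT.
(* Now (k - 1)(d - 1) < n - 1 <= m(d - 1) forces k <= m. The k - 1 = p+1 sets, one of them with 2d -
   2 vertices, reach k(d - 1) >= n vertices and cost k(d+1) colorings. *)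
have [p [pk pm]] : exists p, k = p.+2 /\ k <= m.
  have k2 : 1 < k by case: (k) nk => [|[|]] //; rewrite ?muln0 ?muln1; clear - dn de; lia.
  exists (k - 2); split; first by clear - k2; lia.
  rewrite -ltnS -[k]prednK ?ltnS; last by clear - k2; lia.
  have : (k - 1) * e.+1 < m * e.+1 by clear - nm nk1; lia.
  by rewrite ltn_mul2r subn1.
(* For d = 2 the two bounds on n contradict each other; hence 2d - 2 > d. *)
have e0 : 0 < e by case: (e) nk nk1; rewrite pk => //; clear; lia.
have [|||F [Fc dF rF]] := star_family d C d.+1.*2 (d.*2 - 2) d1 cardC _ _ p _ CT.
- by rewrite de; clear - e0; lia.
- by move=> V /andP[dV Vd]; apply: wide_family => //; clear - d1 Vd; lia.
- by rewrite cardT dn de /=; move: nk; rewrite pk mulnC !mulSn; clear; lia.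
apply: finish Fc _ _ dF rF; last by rewrite pk.
by rewrite -addnn -addnA -!mulSn -pk leq_mul2r pm orbT.
Qed.

(** * The case d = n *)

(** As the prefix grows, its intersection with A grows from 0 to |A| by at most one vertex per step,
    so it passes through |A|/2. *)
Lemma prefix_family :
  exists F, [/\ #|F| <= n.+1, order n F &
    forall A, ~~ odd #|A| -> 0 < #|A| -> bisects F A].
Proof.
pose P k := [set i : 'I_n | i < k].
exists [set bicolor (P k) (~: P k) | k : 'I_n.+1]; split.
- by rewrite -[X in _ <= X]card_ord leq_imset_card.
- by move=> _ /imsetP[k _ ->]; rewrite domain_bicolor setUCr cardsT card_ord.
move=> A eA A0.
have Pn : A :&: P n = A by apply/setIidPl/subsetP => i _; rewrite inE.
have step k : #|A :&: P k.+1| <= #|A :&: P k|.+1.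
  have [kn|nk] := ltnP k n; last first.
    apply/leqW/subset_leq_card/setIS/subsetP => i _.
    by rewrite inE (leq_trans (ltn_ord i)).
  apply: (@leq_trans #|Ordinal kn |: (A :&: P k)|); last by rewrite cardsU1; case: (_ \notin _).
  apply/subset_leq_card/subsetP => i; rewrite !inE ltnS leq_eqVlt -val_eqE.
  by case/andP => -> /orP[->|->]; rewrite ?orbT.
have [|k hk kmin] := @ex_minnP (fun k => #|A|./2 <= #|A :&: P k|).
  by exists n; rewrite Pn; lia.
have kn : k < n.+1 by rewrite ltnS kmin // Pn; lia.
have Ak : #|A :&: P k| = #|A|./2.
  case: k hk kmin {kn} => [|k] hk kmin.
    have P0 : A :&: P 0 = set0 by apply/setP => i; rewrite !inE andbF.
    by move: hk; rewrite P0 cards0; lia.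
  have := step k; have [/kmin|] := leqP #|A|./2 #|A :&: P k|; lia.
exists (bicolor (P k) (~: P k)); first by apply/imsetP; exists (Ordinal kn).
have := cardsID (P k) A; rewrite setDE Ak => cardA.
apply: bicolor_bisected; first by rewrite -setI_eq0 setICr.
  by rewrite Ak; apply: (@addnI #|A|./2); rewrite cardA addnn even_halfK.
by rewrite Ak; lia.
Qed.

End Colorings.

(** * Existence of the minimum and the final bound *)

Lemma min_edge_size_le (n : nat) (G : hypergraph n) A :
  A \in G -> min_edge_size G <= #|A|.
Proof.
rewrite /min_edge_size => AG; have := mem_index_enum A.
elim: (index_enum _) => // B s IH; rewrite inE big_cons => /orP[/eqP<-|/IH As].
  by rewrite AG geq_minl.
by case: ifP => // _; rewrite (leq_trans (geq_minr _ _)).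
Qed.

Lemma is_beta_exists (n d : nat) (G : hypergraph n) (F0 : {set bicoloring n}) :
  induced_bisecting_family d G F0 -> exists b : nat, is_beta d G b.
Proof.
pose fam (F : {set bicoloring n}) := [forall X in F, #|domain X| == d] &&
  [forall A in G, ~~ trivial_edge d A ==> [exists X in F, induced_bisected X A]].
have famP F : reflect (induced_bisecting_family d G F) (fam F).
  apply: (iffP andP) => -[FX FA]; split.
  - by move=> X XF; apply/eqP; exact: (forall_inP FX).
  - by move=> A AG nA; apply/exists_inP; exact: (implyP (forall_inP FA A AG)).
  - by apply/forall_inP => X /FX ->.
  - by apply/forall_inP => A AG; apply/implyP => nA; apply/exists_inP; exact: FA.
move=> /famP F0P; case: (arg_minnP (fun F : {set bicoloring n} => #|F|) F0P) => F /famP FP Fmin.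
by exists #|F|; split=> [|F' /famP/Fmin]; first by exists F.
Qed.

Theorem theorem4 (n d : nat) (G : hypergraph n)
    (hd : 2 <= d) (hdn : d <= n)
    (hk : n - 1 < (d - 1) * min_edge_size G) :
  (d < n -> exists b : nat, is_beta d G b) /\
  (forall b : nat, is_beta d G b ->
     (b%:Z <= Num.ceil ((n%:R - 1) / (d%:R - 1) : rat) * (d%:Z + 1))%R).
Proof.
have family m : d < n -> n - 1 <= m * (d - 1) ->
    exists2 F, induced_bisecting_family d G F & #|F| <= m * d.+1.
  move=> dn nm; have [F [Fc dF rF]] := exists_family n d _ m hd dn hk nm.
  exists F => //; split=> // A AG; rewrite /trivial_edge !negb_or => /and3P[_ _ nA].
  by apply: rF => //; apply: min_edge_size_le.
split=> [dn|b [[F0 F0P F0b] bmin]].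
  (* Any family yields the minimum, so the crude choice m = n - 1 is enough. *)
  have [|F FP _] := family (n - 1) dn; last exact: is_beta_exists FP.
  by rewrite leq_pmulr // subn_gt0.
have d0 : (0 < (d - 1)%:R :> rat)%R by rewrite ltr0n subn_gt0.
have predR k : 0 < k -> (k%:R - 1 = (k - 1)%:R :> rat)%R by move=> k0; rewrite natrB.
rewrite !predR; [|lia..].
set c := Num.ceil _.
have c0 : (0 <= c)%R by rewrite ceil_ge0 (lt_le_trans (ltrN10 _)) // divr_ge0 ?ler0n.
have [m cm] : exists m : nat, c = m%:Z%R by exists `|c|%N; rewrite gez0_abs.
have nm : n - 1 <= m * (d - 1).
  have := ceil_ge ((n - 1)%:R / (d - 1)%:R : rat); rewrite -/c cm ler_pdivrMr //.
  by rewrite -natrM ler_nat.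
suff : b <= m * d.+1 by rewrite cm; lia.
move: hdn; rewrite leq_eqVlt => /orP[/eqP dn|dn]; last first.
  by have [F FP Fc] := family m dn nm; apply: leq_trans Fc; apply: bmin.
subst d; have [F [Fc dF rF]] := prefix_family n.
apply: (@leq_trans n.+1).
  apply: leq_trans Fc; apply: bmin; split=> // A AG nA; apply: rF; last first.
    by rewrite card_gt0; move: nA; rewrite /trivial_edge negb_or => /andP[].
  (* The family [F0] behind [is_beta] has order n, so its member X colors all of [n]; bisecting A
     then forces |A| to be even. *)
  have [X /(proj1 F0P) cardX /andP[/eqP eqA _]] := (proj2 F0P) A AG nA.
  have XT : domain X = [set: 'I_n] by apply/eqP; rewrite eqEcard subsetT cardsT card_ord cardX /=.
  have -> : A = (A :&: color_class X true) :|: (A :&: color_class X false).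
    rewrite -setIUr; apply/esym/setIidPl/subsetP => i _; rewrite !inE.
    have : i \in domain X by rewrite XT inE.
    by rewrite inE; case: (X i) => [[]|].
  rewrite cardsU eqA -setIIr; have -> : color_class X true :&: color_class X false = set0.
    by apply/setP => i; rewrite !inE; case: (X i) => [[]|].
  by rewrite setI0 cards0; lia.
(* Since n >= 2, the bound n - 1 <= m(n - 1) excludes m = 0. *)
by rewrite leq_pmull //; case: (m) nm => //; lia.
Qed.
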